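(* Let $r$ be the unique real number with $7r^5-10r^4-20r^3-4=0$ (so $r\approx2.558$). Then: (1) For $t\in\mathbb{Q}$, $t\neq2$, the field $K_t$ is totally real if and only if $2<t<r$. (2) There exist infinitely many rational numbers $t$ with $2<t<r$ such that the corresponding fields $K_t$ are pairwise distinct.
   Context: For $t\in\mathbb{Q}$, $t\neq2$, put $u=\frac{3t^2-2t+2}{t^2+t-1}$, $v=\frac{t^5-5t^4+10t^3-20t^2+15t-7}{(t-2)(t^2+t-1)^2}$, $w=\frac{-3t^5+10t^4-20t^3+20t^2-20t+6}{(t-2)(t^2+t-1)^2}$, $f_t=X^6+uX^5+vX^4+wX^3+vX^2+uX+1\in\mathbb{Q}[X]$, and let $K_t\subset\overline{\mathbb{Q}}$ be the splitting field of $f_t$ over $\mathbb{Q}$. *)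

(* Defs.v *)
From HB Require Import structures.
From mathcomp Require Import all_boot all_order all_algebra all_field.
Set Implicit Arguments. Unset Strict Implicit. Unset Printing Implicit Defensive.
Import Order.TTheory GRing.Theory Num.Theory.
Local Open Scope ring_scope.

Definition u_t (t : rat) : rat := (3 * t ^+ 2 - 2 * t + 2) / (t ^+ 2 + t - 1).
Definition v_t (t : rat) : rat :=
  (t ^+ 5 - 5 * t ^+ 4 + 10 * t ^+ 3 - 20 * t ^+ 2 + 15 * t - 7)
  / ((t - 2) * (t ^+ 2 + t - 1) ^+ 2).
Definition w_t (t : rat) : rat :=
  (- 3 * t ^+ 5 + 10 * t ^+ 4 - 20 * t ^+ 3 + 20 * t ^+ 2 - 20 * t + 6)
  / ((t - 2) * (t ^+ 2 + t - 1) ^+ 2).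

Definition f_t (t : rat) : {poly rat} :=
  Poly [:: 1; u_t t; v_t t; w_t t; v_t t; u_t t; 1].

Inductive in_splitting_field (p : {poly rat}) : algC -> Prop :=
| sf_rat (q : rat) : in_splitting_field p (ratr q)
| sf_root (x : algC) : root (map_poly ratr p) x -> in_splitting_field p x
| sf_add x y : in_splitting_field p x -> in_splitting_field p y ->
               in_splitting_field p (x + y)
| sf_opp x : in_splitting_field p x -> in_splitting_field p (- x)
| sf_mul x y : in_splitting_field p x -> in_splitting_field p y ->
               in_splitting_field p (x * y)
| sf_inv x : in_splitting_field p x -> in_splitting_field p (x^-1).

Definition K_t (t : rat) : algC -> Prop := in_splitting_field (f_t t).

(* A subfield K of algC is totally real if every field embedding of K into
   the complex numbers (all of which land in algC, K being algebraic) has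
   image contained in the reals. *)
Definition totally_real (K : algC -> Prop) : Prop :=
  forall sigma : algC -> algC,
    sigma 1 = 1 ->
    (forall x y, K x -> K y -> sigma (x + y) = sigma x + sigma y) ->
    (forall x y, K x -> K y -> sigma (x * y) = sigma x * sigma y) ->
    forall x, K x -> sigma x \is Num.real.

(* Main.v *)
Require Import Defs.
From HB Require Import structures.
From mathcomp Require Import all_boot all_order all_algebra all_field.
From mathcomp Require Import ring lra.
From Stdlib Require Import ClassicalEpsilon.
Import Order.TTheory GRing.Theory Num.Theory.
Local Open Scope ring_scope.

(* In terms of y = x + 1/x, the palindromic polynomial f_t becomes a cubic
   g (called resolvent below).  With P = quintic and q = t^2 + t - 1,
   g(2) = P(t) / ((t - 2) q^2), g(-2) = - (t - 2)^4 / q^2 and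
   disc g = - 25 P(t) R(t)^2 / ((t - 2)^3 q^6), where R < 0 on the relevant
   interval.  The roots of f_t are real iff g has real roots only, all of them
   satisfying y^2 >= 4.

   If 2 < t < r, then P(t) < 0, so disc g > 0 and the roots y are real; the signs
   of g at 2 and -2 together with u >= 2 (which is (t - 2)^2 >= 0) exclude
   y^2 < 4.  Conversely, K_t contains s, the product of the x_i - 1/x_i over the
   three pairs of roots, and s^2 = g(2) g(-2) has the square class of
   - P(t) (t - 2); if s is real this is nonnegative, which forces 2 < t <= r, and
   P has no rational root.

   For the second part, take t = 2 + p / (2p + 1) with p prime: then
   - P(t) (t - 2) is p times an integer prime to p if p > 5, up to a rational square.  A
   number field contains the square roots of only finitely many square classes,
   so K_t does not contain s for the parameters t' attached to large primes,
   and the primes can be chosen inductively. *)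

(** * The quintic: sign and monotonicity *)

Definition quintic (R : pzRingType) (z : R) : R :=
  7 * z ^+ 5 - 10 * z ^+ 4 - 20 * z ^+ 3 - 4.
Arguments quintic {R} z.

(** At 2 only the constant coefficient is negative, so monotonicity and bounds beyond 2 can be read
    off term by term. *)
Lemma quintic_shift (R : comNzRingType) (h : R) :
  quintic (2 + h) =
  200 * h ^+ 2 + 180 * h ^+ 3 + 60 * h ^+ 4 + 7 * h ^+ 5 - 100.
Proof. rewrite /quintic; ring. Qed.

(* The local maximum of the quintic, at -6/7, is -100/2401; dividing by the square
   factor leaves a cubic that is negative up to 2. *)
Lemma quintic_lt0 (R : numFieldType) (z : R) : z <= 2 -> quintic z < 0.
Proof.
move=> z2; pose s := 2 - z; have s0 : 0 <= s by rewrite subr_ge0.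
have sr : s \is Num.real by rewrite ger0_real.
have zr : z \is Num.real by rewrite (ler_real z2) realn.
have -> : quintic z = - ((z + 6 / 7) ^+ 2 * ((s - 5 / 3) ^+ 2 * (7 * s + 10 / 3)
    + 5 / 21 * s + 3950 / 1323) + 100 / 2401) by rewrite /quintic /s; field.
have sq0 (a : R) : a \is Num.real -> 0 <= a ^+ 2 by move=> ?; rewrite real_exprn_even_ge0.
have n0 (n m : nat) : (0 : R) <= n%:R / m%:R by rewrite divr_ge0 ?ler0n.
have h7 : 0 <= 7 * s + 10 / 3
  by apply: addr_ge0 (mulr_ge0 _ s0) (n0 10 3)%N; rewrite ler0n.
have h5 : 0 <= 5 / 21 * s by apply: mulr_ge0 (n0 5 21)%N s0.
rewrite oppr_lt0; apply: ltr_wpDl; last by apply: divr_gt0; rewrite ltr0n.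
apply: mulr_ge0; first by apply: sq0; rewrite realD // realM ?realV ?realn.
apply: addr_ge0; last exact: n0.
apply: addr_ge0 => //; apply: mulr_ge0 => //.
by apply: sq0; rewrite realB // realM ?realV ?realn.
Qed.

Lemma quintic_homo (R : numFieldType) (x y : R) :
  2 <= x -> x < y -> quintic x < quintic y.
Proof.
move=> x2 xy; have a0 : 0 <= x - 2 by rewrite subr_ge0.
have ab : x - 2 < y - 2 by rewrite ltrD2r.
have e (z : R) : quintic z = quintic (2 + (z - 2)) by rewrite addrC subrK.
rewrite (e x) (e y) !quintic_shift ltrD2r.
have b0 : 0 <= y - 2 by rewrite (le_trans a0) ?ltW.
have le k (c : nat) : c%:R * (x - 2) ^+ k <= c%:R * (y - 2) ^+ k.
  by rewrite ler_wpM2l ?ler0n // lerXn2r ?nnegrE // ltW.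
by do 3![apply: ltr_leD => //]; rewrite ltr_pM2l ?ltr0n // ltrXn2r.
Qed.

(** * Rational zeros excluded by reduction modulo a prime *)

(** At a zero, [p] would divide both numerator and denominator. [F] is polymorphic in the ring so
    that one expression is read over [int], [rat] and ['F_p]. *)
Lemma form_rat_neq0 (F : forall R : comNzRingType, R -> R -> R) (p : nat) :
    prime p ->
    (forall (R : comNzRingType) (x y : int), (F int x y)%:~R = F R x%:~R y%:~R) ->
    (forall x y : 'F_p, F _ x y = 0 -> (x == 0) && (y == 0)) ->
  forall t : rat, F rat (numq t)%:~R (denq t)%:~R != 0.
Proof.
move=> p_pr Fintr F0 t; rewrite -Fintr intr_eq0; apply/eqP => ab0.
have /F0 /andP[] : F 'F_p (numq t)%:~R (denq t)%:~R = 0 by rewrite -Fintr ab0.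
rewrite -!(dvdz_pcharf (pchar_Fp p_pr)) => da db.
have := coprime_num_den t; move/(coprime_dvdl da)/(coprime_dvdr db).
by rewrite /coprime gcdnn => /eqP p1; rewrite (p1 : p = 1%N) in p_pr.
Qed.

Lemma quintic_neq0 (t : rat) : quintic t != 0.
Proof.
pose F (R : comNzRingType) (x y : R) : R :=
  7 * x ^+ 5 - 10 * x ^+ 4 * y - 20 * x ^+ 3 * y ^+ 2 - 4 * y ^+ 5.
suff : F rat (numq t)%:~R (denq t)%:~R != 0.
  apply: contraNneq => P0; rewrite numqE -(mulr0 ((denq t)%:~R ^+ 5)) -P0.
  by rewrite /F /quintic; apply/eqP; ring.
apply: (@form_rat_neq0 F 11) => // [R x y|x y].
  by rewrite /F !(rmorphB, rmorphM, rmorphXn, rmorph_nat).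
(* The 121 pairs of residues modulo 11 are checked by computation. *)
have : all (fun i => all (fun j => (F _ i%:R j%:R == 0 :> 'F_11) ==>
  (i == 0%N) && (j == 0%N)) (iota 0 11)) (iota 0 11) by vm_compute.
move/allP => /(_ (val x)); rewrite mem_iota (ltn_ord x) => /(_ isT).
move/allP => /(_ (val y)); rewrite mem_iota (ltn_ord y) => /(_ isT).
by rewrite !natr_Zp => /implyP h /eqP/h.
Qed.

Lemma quadratic_neq0 (t : rat) : t ^+ 2 + t - 1 != 0.
Proof.
pose F (R : comNzRingType) (x y : R) : R := x ^+ 2 + x * y - y ^+ 2.
suff : F rat (numq t)%:~R (denq t)%:~R != 0.
  apply: contraNneq => P0; rewrite numqE -(mulr0 ((denq t)%:~R ^+ 2)) -P0.
  by rewrite /F; apply/eqP; ring.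
apply: (@form_rat_neq0 F 2) => // [R x y|x y].
  by rewrite /F !(rmorphB, rmorphD, rmorphM, rmorphXn).
by case: x => [[|[]]] //; case: y => [[|[]]].
Qed.

(** * The resolvent cubic, its values at 2 and -2, and its discriminant *)

Definition cubic (R : pzRingType) (b c d y : R) : R :=
  y ^+ 3 + b * y ^+ 2 + c * y + d.
Arguments cubic {R} b c d y.

(** Divide f_t by x^3 and substitute x^2 + x^-2 = y^2 - 2 and x^3 + x^-3 = y^3 - 3y. *)
Definition resolvent (t : rat) : rat -> rat :=
  cubic (u_t t) (v_t t - 3) (w_t t - 2 * u_t t).

Lemma resolvent_2 (t : rat) : t != 2 ->
  resolvent t 2 = quintic t / ((t - 2) * (t ^+ 2 + t - 1) ^+ 2).
Proof.
rewrite -subr_eq0 => t2; have q0 := quadratic_neq0 t.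
rewrite /resolvent /cubic /quintic /u_t /v_t /w_t; field; exact/andP.
Qed.

Lemma resolvent_m2 (t : rat) : t != 2 ->
  resolvent t (- 2) = - (t - 2) ^+ 4 / (t ^+ 2 + t - 1) ^+ 2.
Proof.
rewrite -subr_eq0 => t2; have q0 := quadratic_neq0 t.
rewrite /resolvent /cubic /quintic /u_t /v_t /w_t; field; exact/andP.
Qed.

Definition cubic_disc (R : pzRingType) (b c d : R) : R :=
  b ^+ 2 * c ^+ 2 - 4 * c ^+ 3 - 4 * b ^+ 3 * d - 27 * d ^+ 2 + 18 * b * c * d.
Arguments cubic_disc {R} b c d.

Lemma resolvent_disc (t : rat) : t != 2 ->
  cubic_disc (u_t t) (v_t t - 3) (w_t t - 2 * u_t t) =
  - 25 * quintic t *
    (t ^+ 5 - 4 * t ^+ 4 + 2 * t ^+ 3 + 4 * t ^+ 2 - 2 * t - 1) ^+ 2 /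
    ((t - 2) ^+ 3 * (t ^+ 2 + t - 1) ^+ 6).
Proof.
rewrite -subr_eq0 => t2; have q0 := quadratic_neq0 t.
rewrite /cubic_disc /quintic /u_t /v_t /w_t; field; exact/andP.
Qed.

(** * Real roots of real cubics *)

Lemma sqr_ge0_real (z : algC) : 0 <= z ^+ 2 -> z \is Num.real.
Proof.
move=> z2; have /eqP : z ^+ 2 = sqrtC (z ^+ 2) ^+ 2 by rewrite sqrtCK.
by rewrite eqf_sqr => /orP[] /eqP ->; rewrite ?realN ger0_real ?sqrtC_ge0.
Qed.

Lemma cubic_root_real (b c d y : algC) :
    b \is Num.real -> c \is Num.real -> d \is Num.real ->
    0 < cubic_disc b c d -> cubic b c d y = 0 -> y \is Num.real.
Proof.
move=> br cr dr disc0 y0; pose z := y^*; rewrite CrealE -/z; apply/eqP/esym.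
have z0 : cubic b c d z = 0.
  rewrite -[RHS](rmorph0 Num.conj) -y0 /cubic !(rmorphD, rmorphM, rmorphXn) /=.
  by rewrite (conj_Creal br) (conj_Creal cr) (conj_Creal dr).
apply/eqP; rewrite -subr_eq0; apply: contraTT disc0 => yz.
(* [m] is the third root; the coefficients are rewritten by Vieta so that the discriminant
   factors. *)
pose m := - b - y - z.
have ec : c = - (y ^+ 2 + y * z + z ^+ 2 + b * (y + z)).
  apply: (mulfI yz); apply/eqP; rewrite -subr_eq0.
  by rewrite -[X in _ == X](subrr (cubic b c d y)) {2}y0 -z0 /cubic; apply/eqP; ring.
have ed : d = - (y ^+ 3 + b * y ^+ 2 + c * y).
  by apply/eqP; rewrite -subr_eq0 opprK addrC; apply/eqP.
have eb : b = - (y + z + m) by rewrite /m; ring.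
have -> : cubic_disc b c d = (y - z) ^+ 2 * ((m - y) * (m - z)) ^+ 2.
  by rewrite ed ec eb /cubic_disc; ring.
(* A conjugate pair would make the discriminant nonpositive. *)
have -> : (y - z) ^+ 2 = - `|y - z| ^+ 2.
  by rewrite normCK rmorphB /= conjCK -/z; ring.
have mr : m \is Num.real.
  by rewrite /m -addrA -opprD realB // ?realN // CrealE rmorphD /= conjCK addrC.
have -> : (m - y) * (m - z) = `|m - y| ^+ 2.
  by rewrite normCK rmorphB /= (conj_Creal mr).
rewrite -real_leNgt ?realM ?realN ?realX ?normr_real ?real0 //.
by rewrite mulNr oppr_le0 mulr_ge0 ?exprn_ge0.
Qed.

Lemma cubic_root_large (R : numFieldType) (b c d y : R) : y \is Num.real ->
    2 <= b -> cubic b c d 2 < 0 -> cubic b c d (- 2) < 0 ->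
  cubic b c d y = 0 -> 4 <= y ^+ 2.
Proof.
move=> yr b2 c2 cm2 y0.
have n2 : (2 : R) \is Num.real by rewrite realn.
have [y2|y2] := real_leP n2 yr.
  apply: le_trans (_ : 2 ^+ 2 <= _); first by rewrite -natrX.
  by rewrite lerXn2r ?nnegrE ?(le_trans _ y2).
have nm2 : (- 2 : R) \is Num.real by rewrite realN.
have [ym2|ym2] := real_leP yr nm2.
  rewrite -sqrrN; move: ym2; rewrite lerNr => ym2.
  apply: le_trans (_ : 2 ^+ 2 <= _); first by rewrite -natrX.
  by rewrite lerXn2r ?nnegrE ?(le_trans _ ym2).
(* h(2) < 0 < h(-2) forces b + y < 0, whereas b >= 2 > - y. *)
pose h z := z ^+ 2 + (b + y) * z + (c + (b + y) * y).
have fac z : cubic b c d z = (z - y) * h z.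
  by rewrite -[LHS]subr0 -y0 /cubic /h; ring.
move: c2 cm2; rewrite !fac pmulr_rlt0 ?subr_gt0 // => h2.
rewrite nmulr_rlt0 ?subr_lt0 // => hm2.
have := lt_trans h2 hm2; rewrite -subr_gt0.
have -> : h (- 2) - h 2 = - (4 * (b + y)) by rewrite /h; ring.
have by0 : 0 < b + y.
  by rewrite -(subrr (2 : R)) ler_ltD.
by rewrite oppr_gt0 pmulr_rlt0 // (lt_gtF by0).
Qed.

(** * Embeddings of a splitting field *)

(** An embedding fixes the rationals and permutes the roots of [p]; realness then spreads along the
    generation of the field. *)
Lemma totally_real_splitting (p : {poly rat}) :
    (forall x : algC, root (map_poly ratr p) x -> x \is Num.real) ->
  totally_real (in_splitting_field p).
Proof.
move=> rp sigma sigma1 sigmaD sigmaM; set K := in_splitting_field p.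
have KQ q : K (ratr q) by constructor.
have sigma0 : sigma 0 = 0.
  have := sigmaD _ _ (KQ 0) (KQ 0); rewrite rmorph0 addr0 => /eqP.
  by rewrite -subr_eq subrr eq_sym => /eqP.
have sigmaN x : K x -> sigma (- x) = - sigma x.
  move=> Kx; apply/eqP; rewrite -addr_eq0 addrC -sigmaD ?subrr ?sigma0 //.
  exact: sf_opp.
pose s (q : rat) := sigma (ratr q).
(* [sigma] is a bare function, so its restriction to [rat] is packaged as a ring morphism, of which
   there is only one. *)
have s_add : zmod_morphism s.
  by move=> a b; rewrite /s rmorphB /= sigmaD ?sigmaN; do ?[exact: KQ | apply: sf_opp].
have s_mul : monoid_morphism s.
  by split=> [|a b]; rewrite /s ?rmorph1 // rmorphM sigmaM; do ?exact: KQ.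
pose sA := GRing.isZmodMorphism.Build rat algC s s_add.
pose sM := GRing.isMonoidMorphism.Build rat algC s s_mul.
pose sR : {rmorphism rat -> algC} := HB.pack s sA sM.
have sigmaQ q : sigma (ratr q) = ratr q by rewrite -[LHS]/(sR q) fmorph_eq_rat.
have horner_sigma x q : K x ->
    K (map_poly ratr q).[x] /\
    sigma (map_poly ratr q).[x] = (map_poly ratr q).[sigma x].
  move=> Kx; elim/poly_ind: q => [|q c [Kq sq]].
    by rewrite rmorph0 !horner0; split=> //; have := KQ 0; rewrite rmorph0.
  rewrite rmorphD rmorphM /= map_polyX map_polyC !hornerE.
  have Kqx := sf_mul Kq Kx; have Kc := KQ c; split; first exact: sf_add.
  by rewrite sigmaD // sigmaM // sq sigmaQ.
move=> x; elim=> {x} [q|x px|x y Kx IHx Ky IHy|x Kx IHx|x y Kx IHx Ky IHy|x Kx IHx].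
- by rewrite sigmaQ CrealE fmorph_eq_rat ?conj_Crat // Crat_rat.
- apply: rp; rewrite /root; have [_ <-] := horner_sigma _ p (sf_root px).
  by rewrite (rootP px) sigma0.
- by rewrite sigmaD // realD.
- by rewrite sigmaN // realN.
- by rewrite sigmaM // realM.
(* Zero is its own inverse by convention and is treated apart. *)
have [->|x0] := eqVneq x 0; first by rewrite invr0 sigma0 real0.
have Kxi := sf_inv Kx; have := sigmaM _ _ Kx Kxi; rewrite divff // sigma1 => e.
have sx0 : sigma x != 0.
  by apply: contra_eq_neq e => ->; rewrite mul0r oner_eq0.
by rewrite -(mulKf sx0 (sigma _)) -e mulr1 realV.
Qed.

(** * Reality of the roots of f_t *)

(** This is f_t(x) = x^3 g(x + 1/x). *)
Lemma root_f_t (t : rat) (x : algC) : x != 0 ->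
  root (map_poly ratr (f_t t)) x =
  (cubic (ratr (u_t t)) (ratr (v_t t - 3)) (ratr (w_t t - 2 * u_t t)) (x + x^-1)
   == 0).
Proof.
move=> x0; rewrite /root /f_t map_Poly horner_Poly /= rmorph1.
move: (u_t t) (v_t t) (w_t t) => u v w.
rewrite (rmorphB _ v) (rmorphB _ w) rmorphM !rmorph_nat /cubic.
rewrite -[RHS](mulrI_eq0 _ (mulfI (expf_neq0 3 x0))); congr (_ == 0).
by field.
Qed.

Lemma root_f_t_neq0 (t : rat) (x : algC) :
  root (map_poly ratr (f_t t)) x -> x != 0.
Proof.
apply: contraTneq => ->; rewrite /root horner_coef0 coef_map /f_t.
by rewrite coef_Poly /= rmorph1 oner_eq0.
Qed.

Lemma ratr_cubic (b c d y : rat) :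
  ratr (cubic b c d y) = cubic (ratr b) (ratr c) (ratr d) (ratr y) :> algC.
Proof. by rewrite /cubic; ring. Qed.

Lemma ratr_cubic_disc (b c d : rat) :
  ratr (cubic_disc b c d) = cubic_disc (ratr b) (ratr c) (ratr d) :> algC.
Proof. by rewrite /cubic_disc; ring. Qed.

Lemma ratr_Creal (q : rat) : (ratr q : algC) \is Num.real.
Proof. by rewrite Creal_Crat ?Crat_rat. Qed.

(** A rational stand-in for r, sharp enough to fix the sign of the squared factor of the
    discriminant. *)
Lemma quintic_lt0_ub (t : rat) : quintic t < 0 -> t < 13 / 5.
Proof.
apply: contraTT; rewrite -!leNgt; have [h ->] : exists h, t = 2 + h.
  by exists (t - 2); ring.
move=> ht; have h0 : 3 / 5 <= h by lra.
have h0' : 0 <= h by lra.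
(* The quadratic and cubic terms alone give 72 + 38.88 > 100. *)
have h2 : 9 / 25 <= h ^+ 2 by nra.
have h3 : 27 / 125 <= h ^+ 3 by rewrite exprSr; nra.
have h4 : 0 <= h ^+ 4 by apply: exprn_ge0.
have h5 : 0 <= h ^+ 5 by apply: exprn_ge0.
by rewrite quintic_shift; lra.
Qed.

Lemma quadratic_gt0 (t : rat) : 2 < t -> 0 < t ^+ 2 + t - 1.
Proof. move=> t2; nra. Qed.

Lemma u_t_ge2 (t : rat) : 2 < t -> 2 <= u_t t.
Proof.
move=> t2; have q0 := quadratic_gt0 _ t2.
by rewrite /u_t ler_pdivlMr //; nra.
Qed.

Lemma resolvent_disc_gt0 (t : rat) : 2 < t -> quintic t < 0 ->
  0 < cubic_disc (u_t t) (v_t t - 3) (w_t t - 2 * u_t t).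
Proof.
move=> t2 Pt; have tub := quintic_lt0_ub _ Pt.
have q0 := quadratic_gt0 _ t2.
have tn2 : t != 2 by rewrite gt_eqF.
have den_gt0 : 0 < (t - 2) ^+ 3 * (t ^+ 2 + t - 1) ^+ 6.
  have t20 : 0 < t - 2 by rewrite subr_gt0.
  exact: mulr_gt0 (exprn_gt0 3 t20) (exprn_gt0 6 q0).
have num_gt0 : 0 < - 25 * quintic t.
  by rewrite mulNr oppr_gt0 (pmulr_rlt0 _ (ltr0Sn _ 24)).
rewrite (resolvent_disc _ tn2).
apply: divr_gt0 den_gt0; apply: mulr_gt0 num_gt0 _.
(* The squared factor only has to be nonzero; it is negative on the interval. *)
rewrite -sqrrN; apply: exprn_gt0; rewrite oppr_gt0.
clear q0 tn2 Pt; move: t2 tub.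
have [h ->] : exists h, t = 2 + h by exists (t - 2); ring.
move=> t2 tub; have [h0 h1] : 0 < h /\ h < 3 / 5 by split; lra.
have -> : (2 + h) ^+ 5 - 4 * (2 + h) ^+ 4 + 2 * (2 + h) ^+ 3 +
  4 * (2 + h) ^+ 2 - 2 * (2 + h) - 1 =
  h ^+ 5 + 6 * h ^+ 4 + 10 * h ^+ 3 - 10 * h - 5 by ring.
have h2 : h ^+ 2 < 9 / 25 by nra.
have h2' : 0 < h ^+ 2 by apply: exprn_gt0.
have -> : h ^+ 5 = h * (h ^+ 2 * h ^+ 2) by ring.
have -> : h ^+ 4 = h ^+ 2 * h ^+ 2 by ring.
have -> : h ^+ 3 = h * h ^+ 2 by ring.
(* With 1/6 the quartic term stays below 1, and -10h absorbs the cubic and quintic terms. *)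
have h4 : h ^+ 2 * h ^+ 2 < 1 / 6 by nra.
have h3 : h * h ^+ 2 < h * (9 / 25) by rewrite ltr_pM2l.
have h5 : h * (h ^+ 2 * h ^+ 2) < h * (1 / 6) by rewrite ltr_pM2l.
lra.
Qed.

Lemma resolvent_2_lt0 (t : rat) : 2 < t -> quintic t < 0 -> resolvent t 2 < 0.
Proof.
move=> t2 Pt; have tn2 : t != 2 by rewrite gt_eqF.
rewrite (resolvent_2 _ tn2) pmulr_llt0 //; rewrite invr_gt0.
have t20 : 0 < t - 2 by rewrite subr_gt0.
exact: mulr_gt0 t20 (exprn_gt0 2 (quadratic_gt0 _ t2)).
Qed.

Lemma resolvent_m2_lt0 (t : rat) : 2 < t -> resolvent t (- 2) < 0.
Proof.
move=> t2; have t20 : 0 < t - 2 by rewrite subr_gt0.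
rewrite resolvent_m2 ?gt_eqF // pmulr_llt0 ?oppr_lt0 ?invr_gt0; apply: exprn_gt0 => //.
exact: quadratic_gt0.
Qed.

Lemma roots_f_t_real (t : rat) (x : algC) : 2 < t -> quintic t < 0 ->
  root (map_poly ratr (f_t t)) x -> x \is Num.real.
Proof.
move=> t2 Pt rx; have x0 := root_f_t_neq0 _ _ rx.
move: rx; rewrite root_f_t // => /eqP; set y := x + x^-1 => y0.
have tn2 : t != 2 by rewrite gt_eqF.
have q0 := quadratic_gt0 _ t2.
have yr : y \is Num.real.
  apply: cubic_root_real y0; rewrite ?ratr_Creal // -ratr_cubic_disc ltr0q.
  exact: resolvent_disc_gt0.
have y4 : 4 <= y ^+ 2.
  have e2 : (2 : algC) = ratr 2 by rewrite rmorph_nat.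
  apply: cubic_root_large yr _ _ _ y0; rewrite e2.
  - by rewrite ler_rat u_t_ge2.
  - by rewrite -ratr_cubic ltrq0; apply: resolvent_2_lt0.
  by rewrite -rmorphN -ratr_cubic ltrq0; apply: resolvent_m2_lt0.
(* [x] is half the sum of x + 1/x and x - 1/x. *)
have dr : x - x^-1 \is Num.real.
  apply: sqr_ge0_real; have -> : (x - x^-1) ^+ 2 = y ^+ 2 - 4 by rewrite /y; field.
  by rewrite subr_ge0.
have -> : x = (y + (x - x^-1)) / 2 by rewrite /y; field.
by apply: realM; [apply: realD | rewrite realV realn].
Qed.

(** * A distinguished square root in K_t *)

Lemma cubic_factor (b c d : algC) : exists y1 y2 y3 : algC,
  forall z, cubic b c d z = (z - y1) * (z - y2) * (z - y3).
Proof.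
pose p := Poly [:: d; c; b; 1].
have sp : p = [:: d; c; b; 1] :> seq algC by rewrite (PolyK (c := 0)) ?oner_eq0.
have [r rp] := closed_field_poly_normal p.
have lp : lead_coef p = 1 by rewrite lead_coefE sp.
rewrite lp scale1r in rp.
have : size r = 3 by have := congr1 size sp; rewrite rp size_prod_XsubC => -[].
case: r rp => [|y1 [|y2 [|y3 []]]] // rp _; exists y1, y2, y3 => z.
transitivity p.[z].
  by rewrite horner_coef sp !big_ord_recl big_ord0 /cubic /=; ring.
by rewrite rp !big_cons big_nil !hornerE /=; ring.
Qed.

(** As (2 - y)(-2 - y) = y^2 - 4 = (x - 1/x)^2, the product over the three roots y of g is g(2)
    g(-2). *)
Lemma sqrt_resolvent (t : rat) : exists s : algC,
  K_t t s /\ s ^+ 2 = ratr (resolvent t 2 * resolvent t (- 2)).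
Proof.
set b : algC := ratr (u_t t); set c : algC := ratr (v_t t - 3).
set d : algC := ratr (w_t t - 2 * u_t t).
have [y1 [y2 [y3 ey]]] := cubic_factor b c d.
(* [x] solves x + 1/x = y, its inverse being y - x. *)
have ex y : cubic b c d y = 0 -> exists2 z, K_t t z & z ^+ 2 = y ^+ 2 - 4.
  move=> y0; pose x := (y + sqrtC (y ^+ 2 - 4)) / 2.
  have e : x * (y - x) = 1.
    have -> : x * (y - x) = (y ^+ 2 - sqrtC (y ^+ 2 - 4) ^+ 2) / 4 by rewrite /x; field.
    by rewrite sqrtCK; field.
  have x0 : x != 0 by apply: contra_eq_neq e => ->; rewrite mul0r eq_sym oner_eq0.
  have xi : x^-1 = y - x by rewrite -(mulKf x0 (y - x)) e mulr1.
  have Kx : K_t t x.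
    by apply: sf_root; rewrite root_f_t // xi [x + _]addrC subrK; apply/eqP.
  exists (x - x^-1); first by apply: sf_add => //; apply/sf_opp/sf_inv.
  have -> : (x - x^-1) ^+ 2 = (x + x^-1) ^+ 2 - 4 by field.
  by rewrite xi [x + _]addrC subrK.
have [z1 K1 s1] : exists2 z, K_t t z & z ^+ 2 = y1 ^+ 2 - 4.
  by apply: ex; rewrite ey subrr !mul0r.
have [z2 K2 s2] : exists2 z, K_t t z & z ^+ 2 = y2 ^+ 2 - 4.
  by apply: ex; rewrite ey subrr mulr0 mul0r.
have [z3 K3 s3] : exists2 z, K_t t z & z ^+ 2 = y3 ^+ 2 - 4.
  by apply: ex; rewrite ey subrr mulr0.
exists (z1 * z2 * z3); split; first by apply: sf_mul => //; apply: sf_mul.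
have rE y : ratr (resolvent t y) = cubic b c d (ratr y) := ratr_cubic _ _ _ _.
rewrite rmorphM /= !rE rmorphN rmorph_nat !ey.
by rewrite !exprMn s1 s2 s3; ring.
Qed.

(** * Square classes in a number field *)

(** Transfers the predicate on [algC] to a finite extension of [rat], where Galois theory
    applies. *)
Lemma splitting_number_field (p : {poly rat}) : p != 0 ->
  exists (L : splittingFieldType rat) (LC : {rmorphism L -> algC}),
    forall x, in_splitting_field p x -> exists x', LC x' = x.
Proof.
move=> p0; have [r rp] := closed_field_poly_normal (map_poly ratr p : {poly algC}).
have lp0 : lead_coef (map_poly ratr p : {poly algC}) != 0.
  by rewrite lead_coef_eq0 map_poly_eq0.
have [Qn [QnC [s rs genQ]]] := num_field_exists r.
have Dp : map_poly QnC (map_poly (in_alg Qn) p) = map_poly ratr p.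
  by rewrite -map_poly_comp; apply: eq_map_poly => q; rewrite /= alg_num_field fmorph_rat.
have Qn_ax : FieldExt_isSplittingField _ Qn.
  constructor; exists (map_poly (in_alg Qn) p); first exact: alg_polyOver.
  exists s => //; rewrite -(eqp_map QnC) Dp rp -rs rmorph_prod big_map /=.
  under eq_bigr do rewrite -map_polyXsubC.
  exact: eqp_scale.
pose L : splittingFieldType rat := HB.pack_for (splittingFieldType rat) Qn Qn_ax.
exists L, QnC => x; elim=> {x}.
- by move=> q; exists (ratr q); rewrite fmorph_rat.
- move=> x; rewrite rp rootZ // root_prod_XsubC -rs => /mapP[x' _ ->].
  by exists x'.
- by move=> x y _ [x' <-] _ [y' <-]; exists (x' + y'); rewrite rmorphD.
- by move=> x _ [x' <-]; exists (- x'); rewrite rmorphN.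
- by move=> x y _ [x' <-] _ [y' <-]; exists (x' * y'); rewrite rmorphM.
by move=> x _ [x' <-]; exists (x'^-1); rewrite fmorphV.
Qed.

(* chi records which Galois automorphisms fix the square root: equal patterns make
   the product of the two square roots Galois invariant, hence rational. *)
Lemma sqrt_classes_finite (p : {poly rat}) : p != 0 ->
  exists (T : finType) (chi : algC -> T), forall (x y : algC) (a b : rat),
    in_splitting_field p x -> in_splitting_field p y ->
    x ^+ 2 = ratr a -> y ^+ 2 = ratr b -> a != 0 -> b != 0 -> chi x = chi y ->
  exists c : rat, a * b = c ^+ 2.
Proof.
move=> /splitting_number_field[L [LC KL]].
have galL : galois 1 {:L}.
  apply/and3P; split; first exact: sub1v.
    by apply/separableP => u _; apply/pcharf0_separable/(ftrans (pchar_lalg L))/pchar_num.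
  have [q q1 sq] := splittingFieldP L.
  by apply/splitting_normalField; [exact: sub1v | exists q].
(* The left inverse [CL] of [LC] lets [chi] be defined on all of [algC]. *)
have [CL _ LCK] := num_field_proj LC.
exists {ffun gal_of {:L} -> bool}, (fun x => [ffun s : gal_of {:L} => s (CL x) == CL x]).
move=> x y a b /KL[x' <-] /KL[y' <-]; rewrite -!rmorphXn -!(fmorph_rat LC).
move=> /fmorph_inj ea /fmorph_inj eb a0 b0; rewrite !LCK => chixy.
have sgn (s : gal_of {:L}) z q : z ^+ 2 = ratr q -> s z = z \/ s z = - z.
  move=> zq; have /eqP : s z ^+ 2 = z ^+ 2 by rewrite -rmorphXn zq fmorph_rat.
  by rewrite eqf_sqr => /orP[] /eqP ->; [left | right].
have : x' * y' \in fixedField 'Gal({:L} / 1)%g.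
  apply/fixedFieldP; rewrite ?memvf // => s _.
  have -> : s (x' * y') = s x' * s y' by rewrite rmorphM.
  have /ffunP/(_ s) := chixy; rewrite !ffunE.
  have [->|ex] := sgn s _ _ ea; first by rewrite eqxx => /esym/eqP ->.
  have [->|->] := sgn s _ _ eb; last by rewrite ex mulrNN.
  by rewrite eqxx => /eqP ->.
have /galois_fixedField -> := galL; case/vlineP => c xyc; exists c.
apply: (fmorph_inj (in_alg L)); rewrite rmorphM rmorphXn /= -xyc exprMn ea eb.
by rewrite !alg_num_field.
Qed.

(** * Parameters attached to primes *)

Lemma resolvent_2_m2 (t : rat) : t != 2 ->
  resolvent t 2 * resolvent t (- 2) =
  - quintic t * (t - 2) * ((t - 2) / (t ^+ 2 + t - 1) ^+ 2) ^+ 2.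
Proof.
move=> tn2; rewrite (resolvent_2 _ tn2) (resolvent_m2 _ tn2).
have q0 := quadratic_neq0 t; rewrite -subr_eq0 in tn2.
move: (quintic t) => P; field; exact/andP.
Qed.

(** The numerator [p] of [sample p - 2] puts one factor [p] into the square class, and
    [sample p - 2] < 1/2 keeps the parameter below r. *)
Definition sample (p : nat) : rat := 2 + p%:R / (2 * p + 1)%:R.

(** Equals -(2p + 1)^5 P([sample p]), in a form that shows positivity and the residue 100 modulo
    [p]. *)
Definition cofactor (p : nat) : nat :=
  (753 * p ^ 4 + 4820 * p ^ 3 + 6620 * p ^ 2 + 3800 * p + 1000) * p + 100.

Lemma quintic_sample (p : nat) :
  - quintic (sample p) * (sample p - 2) =
  (p * cofactor p)%:R / ((2 * p + 1)%:R ^+ 3) ^+ 2.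
Proof.
have poly_nat (a b c d e f : nat) :
  ((a * p ^ 4 + b * p ^ 3 + c * p ^ 2 + d * p + e) * p + f)%:R =
  (a%:R * p%:R ^+ 4 + b%:R * p%:R ^+ 3 + c%:R * p%:R ^+ 2 + d%:R * p%:R
  + e%:R) * p%:R + f%:R :> rat by rewrite -!natrX -!natrM -!natrD -natrM -natrD.
have sample_poly (x : rat) : 2 * x + 1 != 0 ->
  - quintic (2 + x / (2 * x + 1)) * (2 + x / (2 * x + 1) - 2) =
  x * ((753 * x ^+ 4 + 4820 * x ^+ 3 + 6620 * x ^+ 2 + 3800 * x + 1000) * x
  + 100) / ((2 * x + 1) ^+ 3) ^+ 2.
  by move=> m0; rewrite quintic_shift; field.
have eA := natrM rat p (cofactor p).
have em : (2 * p + 1)%:R = 2 * p%:R + 1 :> rat by rewrite natrD natrM.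
have m0 : (2 * p + 1)%:R != 0 :> rat by rewrite addn1 pnatr_eq0.
rewrite em in m0; rewrite eA /sample em (sample_poly _ m0).
by congr (_ * _ / _); rewrite -poly_nat.
Qed.

Lemma sample_gt2 (p : nat) : (0 < p)%N -> 2 < sample p.
Proof.
by move=> p0; rewrite /sample ltrDl divr_gt0 // ltr0n // addn1.
Qed.

Lemma quintic_sample_lt0 (p : nat) : (0 < p)%N -> quintic (sample p) < 0.
Proof.
move=> p0; have t2 : 0 < sample p - 2 by rewrite subr_gt0 sample_gt2.
rewrite -oppr_gt0 -(pmulr_lgt0 _ t2) quintic_sample divr_gt0 //.
  by rewrite ltr0n muln_gt0 p0 /cofactor addn_gt0 orbT.
by rewrite exprn_gt0 // exprn_gt0 // ltr0n addn1.
Qed.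

(** Clearing denominators gives n d^2 = m^2 in [nat], where parities of valuations are compared. *)
Lemma logn_rat_square (n q : nat) (c : rat) :
  (0 < n)%N -> n%:R = c ^+ 2 -> ~~ odd (logn q n).
Proof.
move=> n0 nc; have sq (x : int) : (`|x|%N)%:R ^+ 2 = x%:~R ^+ 2 :> rat.
  by rewrite natr_absz intr_norm real_normK ?num_real.
have e : (n * `|denq c| ^ 2 = `|numq c| ^ 2)%N.
  by apply/eqP; rewrite -(eqr_nat rat) natrM !natrX !sq nc numqE exprMn.
have := congr1 (fun k => odd (logn q k)) e.
have d0 : (0 < `|denq c|)%N by rewrite absz_gt0 denq_eq0.
by rewrite lognM ?expn_gt0 ?d0 // !lognX oddD !oddM addbF => ->.
Qed.

Lemma logn_cofactor (q : nat) : prime q -> (100 < q)%N ->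
  logn q (q * cofactor q) = 1%N.
Proof.
move=> q_pr q100; have A0 : (0 < cofactor q)%N by rewrite addn_gt0 orbT.
have qA : (q %| cofactor q)%N = false.
  by rewrite /cofactor dvdn_addr ?dvdn_mull // gtnNdvd.
rewrite (lognM q (prime_gt0 q_pr) A0) [logn q q](@pfactorK q 1) //.
by rewrite [logn q (cofactor q)]lognE qA !andbF.
Qed.

(** Two primes with the same value of [chi] make [E p * E q] a square, impossible for large q, which
    then divides it to odd order. Finitely many values leave a uniform bound. *)
Lemma sample_sqrt_bound (t : rat) : exists N : nat, forall q : nat,
  prime q -> (N < q)%N -> forall s : algC,
  s ^+ 2 = ratr (resolvent (sample q) 2 * resolvent (sample q) (- 2)) ->
  ~ K_t t s.
Proof.
have f0 : f_t t != 0.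
  apply/eqP => /(congr1 (fun p : {poly rat} => p`_0)).
  by rewrite coef_Poly coef0 /= => /eqP; rewrite oner_eq0.
have [T [chi chiP]] := sqrt_classes_finite _ f0.
pose E p := resolvent (sample p) 2 * resolvent (sample p) (- 2).
have Ep p : (0 < p)%N -> exists2 k : rat, k != 0 & E p = (p * cofactor p)%:R * k ^+ 2.
  move=> p0; have t2 := sample_gt2 _ p0; have tn2 : sample p != 2 by rewrite gt_eqF.
  exists ((sample p - 2) / (sample p ^+ 2 + sample p - 1) ^+ 2 / (2 * p + 1)%:R ^+ 3).
    have m0 : (2 * p + 1)%:R != 0 :> rat by rewrite addn1 pnatr_eq0.
    by rewrite !mulf_neq0 ?invr_eq0 ?expf_neq0 ?quadratic_neq0 ?subr_eq0.
  have sqrD (X Y M : rat) : X / M ^+ 2 * Y ^+ 2 = X * (Y / M) ^+ 2.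
    by rewrite expr_div_n mulrAC -mulrA.
  rewrite /E (resolvent_2_m2 _ tn2) quintic_sample; exact: sqrD.
have pA0 p : (0 < p)%N -> (0 < p * cofactor p)%N.
  by move=> p0; rewrite muln_gt0 p0 /cofactor addn_gt0 orbT.
have E0 p : (0 < p)%N -> E p != 0.
  move=> p0; have [k k0 ->] := Ep p p0.
  by rewrite mulf_neq0 ?expf_neq0 // pnatr_eq0 -lt0n pA0.
have bound (a : T) : exists N : nat, forall q, prime q -> (N < q)%N ->
    forall s, s ^+ 2 = ratr (E q) -> K_t t s -> chi s <> a.
  have [[p [s [p_pr sp Ks chis]]]|none] := classic (exists p s,
      [/\ prime p, s ^+ 2 = ratr (E p), K_t t s & chi s = a]); last first.
    by exists 0%N => q q_pr _ s sq Ks chis; apply: none; exists q, s.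
  (* Such a [q] is too large to divide [p * cofactor p]. *)
  exists (maxn 100 (p * cofactor p)) => q q_pr.
  rewrite gtn_max => /andP[q100 qp] s' sq Ks' chis'.
  have p0 := prime_gt0 p_pr; have q0 := prime_gt0 q_pr.
  have [c] := chiP s s' _ _ Ks Ks' sp sq (E0 p p0) (E0 q q0) (etrans chis (esym chis')).
  have [k k0 ->] := Ep p p0; have [l l0 ->] := Ep q q0 => ec.
  have : ~~ odd (logn q (p * cofactor p * (q * cofactor q))).
    apply: (@logn_rat_square _ _ (c / (k * l))); first by rewrite muln_gt0 !pA0.
    rewrite natrM exprMn -ec exprVn exprMn; move: (_%:R) (_%:R) => x y.
    by field; exact/andP.
  rewrite lognM ?pA0 // logn_cofactor // lognE q_pr pA0 //= gtnNdvd ?pA0 //.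
have [N Nb] := fin_all_exists bound.
exists (\max_a N a)%N => q q_pr Nq s sq Ks.
apply: (Nb (chi s) q q_pr _ s sq Ks) => //.
exact: leq_ltn_trans (leq_bigmax _) Nq.
Qed.

(** * The criterion and the infinite family *)

Lemma totally_real_quintic (t : rat) : t != 2 ->
  totally_real (K_t t) <-> 2 < t /\ quintic t < 0.
Proof.
move=> tn2; split=> [trK|[t2 Pt]]; last first.
  by apply: totally_real_splitting => x; apply: roots_f_t_real.
have [s [Ks s2]] := sqrt_resolvent t.
(* The identity is one of the embeddings, so [s] itself is real. *)
have : 0 <= s ^+ 2.
  by rewrite real_exprn_even_ge0 //; apply: (trK id).
rewrite s2 ler0q (resolvent_2_m2 _ tn2).
have k0 : (t - 2) / (t ^+ 2 + t - 1) ^+ 2 != 0.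
  by rewrite mulf_neq0 ?invr_eq0 ?expf_neq0 ?quadratic_neq0 ?subr_eq0.
have k2 : 0 < ((t - 2) / (t ^+ 2 + t - 1) ^+ 2) ^+ 2.
  by rewrite lt_neqAle sqr_ge0 eq_sym expf_neq0.
rewrite (pmulr_lge0 _ k2) => h; have [t2|t2|te] := ltgtP t 2.
- have Pt := quintic_lt0 _ _ (ltW t2); rewrite -subr_lt0 in t2.
  by move: h; rewrite (nmulr_lge0 _ t2) oppr_le0 leNgt Pt.
- split; first by [].
  rewrite lt_neqAle quintic_neq0; rewrite -subr_gt0 in t2.
  by move: h; rewrite (pmulr_lge0 _ t2) oppr_ge0.
by rewrite te eqxx in tn2.
Qed.

Lemma ratr_quintic (t : rat) : ratr (quintic t) = quintic (ratr t) :> algC.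
Proof. by rewrite /quintic; ring. Qed.

(** [quintic_lt0] places [r] beyond 2, where the quintic increases. *)
Lemma quintic_lt0_root (r : algC) (t : rat) :
  r \is Num.real -> quintic r = 0 -> 2 < t -> (quintic t < 0) = (ratr t < r).
Proof.
move=> rr r0 t2; have e2 : (2 : algC) = ratr 2 by rewrite rmorph_nat.
have r2 : 2 <= r.
  rewrite real_leNgt ?realn //; apply/negP => /ltW/quintic_lt0.
  by rewrite r0 ltxx.
have t2' : 2 <= ratr t :> algC by rewrite e2 ler_rat ltW.
rewrite -(ltrq0 algC) ratr_quintic; have [lt_rt|] := real_ltP (ratr_Creal t) rr.
  by rewrite -r0 quintic_homo.
rewrite le_eqVlt => /orP[/eqP <-|/(quintic_homo _ _ _ r2)]; first by rewrite r0 ltxx.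
by rewrite r0 => /lt_gtF.
Qed.

Theorem theorem2 (r : algC) :
  r \is Num.real ->
  7 * r ^+ 5 - 10 * r ^+ 4 - 20 * r ^+ 3 - 4 = 0 ->
  (forall t : rat, t != 2 ->
     (totally_real (K_t t) <-> (2 < t /\ (ratr t : algC) < r)))
  /\
  (exists g : nat -> rat,
     (forall n, 2 < g n /\ (ratr (g n) : algC) < r) /\
     (forall n m, n <> m -> ~ (forall x, K_t (g n) x <-> K_t (g m) x))).
Proof.
move=> rr r0; split=> [t tn2|].
  rewrite (totally_real_quintic _ tn2).
  by split=> -[t2]; rewrite (quintic_lt0_root _ _ rr r0 t2).
have [N NP] : exists N : nat -> nat, forall p q, prime q -> (N p < q)%N ->
    forall s : algC,
    s ^+ 2 = ratr (resolvent (sample q) 2 * resolvent (sample q) (- 2)) ->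
    ~ K_t (sample p) s.
  pose bound p := constructive_indefinite_description _ (sample_sqrt_bound (sample p)).
  by exists (fun p => proj1_sig (bound p)) => p; apply: proj2_sig (bound p).
(* The next prime exceeds [p] and the bounds of all parameters up to [p]. *)
pose next p := s2val (prime_above (maxn p (\max_(k < p.+1) N k))).
have next_gt p : (p < next p)%N.
  by rewrite /next; case: prime_above => q /=; rewrite gtn_max => /andP[].
have next_prime p : prime (next p) by rewrite /next; case: prime_above.
have nextN p k : (k <= p)%N -> (N k < next p)%N.
  rewrite /next; case: prime_above => q /=; rewrite gtn_max => /andP[_ Nq] _ kp.
  exact: leq_ltn_trans (leq_bigmax (Ordinal (kp : k < p.+1)%N)) Nq.
(* At least one iteration, since the seed 0 is not prime. *)
pose P n := iter n.+1 next 0%N.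
have P_prime n : prime (P n) by apply: next_prime.
have P_le n m : (n <= m)%N -> (P n <= P m)%N.
  move/subnK <-; elim: (m - n)%N => // k /leq_trans; apply.
  exact: ltnW (next_gt (P (k + n)%N)).
have distinct n m : (n < m)%N ->
    ~ (forall x, K_t (sample (P n)) x <-> K_t (sample (P m)) x).
  case: m => // m nm eqK; have [s [Ks s2]] := sqrt_resolvent (sample (P m.+1)).
  have lt_N := nextN _ _ (P_le n m nm).
  apply: (NP _ _ (P_prime m.+1) lt_N s s2).
  by apply/eqK.
exists (fun n => sample (P n)); split=> [n|n m /eqP].
  have t2 := sample_gt2 _ (prime_gt0 (P_prime n)).
  split=> //; rewrite -(quintic_lt0_root _ _ rr r0 t2).
  exact: quintic_sample_lt0 (prime_gt0 (P_prime n)).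
rewrite neq_ltn => /orP[|/distinct d eqK]; first exact: distinct.
by apply: d => x; split=> /eqK.
Qed.
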